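(* There exists an absolute constant $K$ such that for every $n\ge 1$ and every connected graph $G$ on $n$ vertices, $\mathrm{ept}(G)\le \frac{n}{2}+K$.
   Context: Graphs are finite and simple. Probabilistic zero forcing on a graph $G=(V,E)$: every vertex is blue or white; start from a nonempty set $S\subseteq V$ of blue vertices, all others being white. At each time step, if $B$ is the current set of blue vertices, every $u\in B$ attempts to force each of its white neighbors $v$ to become blue, independently (over all such pairs $(u,v)$, and over time given the current blue set), with success probability $\mathbb{P}(u\to v)=\frac{|N[u]\cap B|}{\deg(u)}$, where $N[u]$ is the closed neighborhood of $u$ (the vertex $u$ together with its neighbors). A white vertex becomes blue if at least one attempt on it succeeds; blue vertices remain blue. The propagation time $\mathrm{pt}_{\mathrm{pzf}}(G,S)$ is the random number of steps until all vertices of $G$ are blue starting from initial blue set $S$. The expected propagation time of $G$ is $\mathrm{ept}(G)=\min_{v\in V}\mathbb{E}[\mathrm{pt}_{\mathrm{pzf}}(G,\{v\})]$. *)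

(* Defs.v *)
From HB Require Import structures.
From mathcomp Require Import all_boot all_order all_algebra.
From mathcomp Require Import all_classical all_reals all_analysis.

Set Implicit Arguments.
Unset Strict Implicit.
Unset Printing Implicit Defensive.

Import Order.TTheory GRing.Theory Num.Theory.

Local Open Scope ring_scope.

(* A finite simple graph is a symmetric irreflexive relation [e] on a finite
   type [T] of vertices. *)

Definition simple_graph (T : finType) (e : rel T) : Prop :=
  symmetric e /\ irreflexive e.

Definition connected_graph (T : finType) (e : rel T) : Prop :=
  forall x y : T, connect e x y.

Definition neighbors (T : finType) (e : rel T) (u : T) : {set T} :=
  [set v | e u v].

Definition closed_neighbors (T : finType) (e : rel T) (u : T) : {set T} :=
  u |: neighbors e u.

Definition deg (T : finType) (e : rel T) (u : T) : nat := #|neighbors e u|.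

(* P(u -> v) when the blue set is B; it does not depend on v. *)
Definition force_prob (R : realType) (T : finType) (e : rel T) (B : {set T})
    (u : T) : R :=
  #|closed_neighbors e u :&: B|%:R / (deg e u)%:R.

Definition attempts (T : finType) (e : rel T) (B : {set T}) : {set T * T} :=
  [set p | [&& p.1 \in B, p.2 \notin B & e p.1 p.2]].

(* The probability that, among the independent attempts made from B, exactly
   those in A succeed (for A a subset of [attempts e B]). *)
Definition success_prob (R : realType) (T : finType) (e : rel T) (B : {set T})
    (A : {set T * T}) : R :=
  \prod_(p in attempts e B)
    (if p \in A then force_prob R e B p.1 else 1 - force_prob R e B p.1).

(* The one-step transition probability from blue set B to blue set C. *)
Definition step_prob (R : realType) (T : finType) (e : rel T)
    (B C : {set T}) : R :=
  \sum_(A : {set T * T} | (A \subset attempts e B) &&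
                          (B :|: [set p.2 | p in A] == C))
    success_prob R e B A.

(* The probability that the first k steps of the process follow the
   trajectory b 0, ..., b k, given that it starts at b 0. *)
Definition trajectory_prob (R : realType) (T : finType) (e : rel T) (k : nat)
    (b : {ffun 'I_k.+1 -> {set T}}) : R :=
  \prod_(i < k) step_prob R e (b (widen_ord (leqnSn k) i)) (b (lift ord0 i)).

(* P(pt_pzf(G, S) = k): all vertices are blue at time k and not before. *)
Definition pt_prob (R : realType) (T : finType) (e : rel T) (S : {set T})
    (k : nat) : R :=
  \sum_(b : {ffun 'I_k.+1 -> {set T}} |
      [&& b ord0 == S, b ord_max == [set: T]
        & [forall i : 'I_k, b (widen_ord (leqnSn k) i) != [set: T]]])
    trajectory_prob R e b.

Local Open Scope ereal_scope.

(* P(pt_pzf(G, S) = +oo) *)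
Definition pt_infty_prob (R : realType) (T : finType) (e : rel T)
    (S : {set T}) : \bar R :=
  1 - \sum_(0 <= k <oo) (pt_prob R e S k)%:E.

(* E[pt_pzf(G, S)], as an extended real; the last term is 0 when the
   propagation time is almost surely finite, since +oo * 0 = 0 in \bar R. *)
Definition expected_pt (R : realType) (T : finType) (e : rel T)
    (S : {set T}) : \bar R :=
  \sum_(0 <= k <oo) (k%:R * pt_prob R e S k)%:E + +oo * pt_infty_prob R e S.

Definition ept (R : realType) (T : finType) (e : rel T) : \bar R :=
  \big[Order.min/+oo]_(v : T) expected_pt R e [set v].

(* Main.v *)
(* Measure a path by charging 6 to each vertex it enters, 7 if that vertex has
   degree at least 3, and start from a centre [r] of the resulting metric.

   Fix a vertex [v], a geodesic from [r] to [v] with vertex set [P], and let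
   [outer P] be the set of vertices outside [P] adjacent to [P].  Until [v] is
   blue, some blue vertex [u] of [P] precedes a white one; if [u] has [b] blue
   closed neighbors and [w] white ones, each of the latter is forced with
   probability [b / (b + w - 1)].  Give weight 60 to a white vertex of [P] and
   29 (just below one half of 60) to a white vertex of [outer P].  If [w = 1],
   the weight drops by 60 surely; otherwise the mean drop is more than 60 when
   [b >= 3] and almost 60 when [b = 2], and a bonus of 5 for every vertex of [P]
   of degree at least 3 with at most two blue closed neighbors covers the
   deficit (a bonus at [r] covers [b = 1]).  As the drop is deterministic
   whenever its mean is not strictly above 60, for [t] close to 1 the variable
   [t ^- weight], set to 0 once [v] is blue, contracts in mean by a factor
   [t ^+ 60] at each step.

   Since [r] is a centre, there is a geodesic from [r], about as long as the
   eccentricity of [r], whose closed neighborhood is disjoint from that of [P]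
   except near [r].  Counting vertices, the initial weight is at most 30 n plus
   a constant, and the slack in this bound is large enough for the sum over all
   [v] of the initial values [t ^- weight] to be O(t ^- (30 n)).  Hence the
   probability that the process lasts n/2 + j steps decays geometrically in
   [j]. *)

Require Import Defs.
From mathcomp Require Import all_boot all_order all_algebra.
From mathcomp Require Import all_classical all_reals all_analysis.
From mathcomp Require Import zify lra ring.

Set Implicit Arguments.
Unset Strict Implicit.
Unset Printing Implicit Defensive.

Import Order.TTheory GRing.Theory Num.Theory.
Import numFieldNormedType.Exports.

(** * Weighted distances *)

Local Open Scope nat_scope.

Section WeightedDistance.

Variables (T : finType) (e : rel T).
Hypotheses (e_sym : symmetric e) (e_conn : connected_graph e).

Definition big_deg (x : T) : bool := 2 < deg e x.

(** Five times [len x] is 30, half the weight 60 of a vertex of [P], plus the bonus 5 of a vertex of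
    degree at least 3; this makes costs of geodesics comparable with distances. *)
Definition len (x : T) : nat := 6 + big_deg x.

Definition plen (p : seq T) : nat := \sum_(x <- p) len x.

Definition walk_of_len (x y : T) (k : nat) : Prop :=
  exists p, [/\ path e x p, last x p = y & plen p = k].

Lemma plen_cat p q : plen (p ++ q) = plen p + plen q.
Proof. by rewrite /plen big_cat. Qed.

Lemma len_bounds x : 6 <= len x <= 7.
Proof. by rewrite /len; case: big_deg. Qed.

Lemma ex_walk x y : exists k, `[< walk_of_len x y k >].
Proof.
have /connectP[p pP ->] := e_conn x y.
by exists (plen p); apply/asboolP; exists p.
Qed.

Definition dist (x y : T) : nat := ex_minn (ex_walk x y).

Lemma dist_walk x y : walk_of_len x y (dist x y).
Proof. by rewrite /dist; case: ex_minnP => k /asboolP. Qed.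

Lemma dist_le_plen x p : path e x p -> dist x (last x p) <= plen p.
Proof.
move=> pP; rewrite /dist; case: ex_minnP => k _; apply.
by apply/asboolP; exists p.
Qed.

Lemma dist_triangle y x z : dist x z <= dist x y + dist y z.
Proof.
have [p [pP py pl]] := dist_walk x y; have [q [qP qz ql]] := dist_walk y z.
rewrite -pl -ql -plen_cat -qz -py -last_cat; apply: dist_le_plen.
by rewrite cat_path pP py.
Qed.

Lemma distxx x : dist x x = 0.
Proof. by have := @dist_le_plen x [::] isT; rewrite /plen big_nil /=; lia. Qed.

Lemma dist_edge x y : e x y -> dist x y <= 7.
Proof.
move=> xy; have := @dist_le_plen x [:: y]; rewrite /= xy => /(_ isT).
by rewrite /plen big_seq1 => /leq_trans; apply; case/andP: (len_bounds y).
Qed.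

Lemma dist_neq x y : x != y -> 6 <= dist x y.
Proof.
have [[|z p] [_ /= <- <-]] := dist_walk x y; first by rewrite eqxx.
move=> _; rewrite /plen big_cons.
by have /andP[+ _] := len_bounds z; lia.
Qed.

(** A walk pays for its end but not for its start, so [dist] is not symmetric; reversal merely
    trades the charge of one end for that of the other. *)
Lemma dist_rev x y : dist y x <= dist x y + 7.
Proof.
have [[|z p] [pP <- <-]] := dist_walk x y; first exact: leq_addr.
have : path e (last x (z :: p)) (rev (belast x (z :: p))).
  by rewrite rev_path (eq_path (e' := e)) // => u v; rewrite e_sym.
move=> /dist_le_plen; rewrite /= rev_cons last_rcons => /leq_trans; apply.
have -> : plen (rcons (rev (belast z p)) x) = plen (belast z p) + len x.
  by rewrite /plen big_rcons (perm_big _ (permEl (perm_rev _))) /= addnC.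
have -> : plen (z :: p) = plen (rcons (belast z p) (last z p)).
  by rewrite -lastI.
rewrite /plen big_rcons /=.
have /andP[_ ?] := len_bounds x; lia.
Qed.

Definition geodesic (x : T) (p : seq T) : Prop :=
  [/\ path e x p, uniq (x :: p) & plen p = dist x (last x p)].

Lemma ex_geodesic x y : exists2 p, geodesic x p & last x p = y.
Proof.
have [p [pP <- pl]] := dist_walk x y.
case/shortenP: pP pl => q qP q_uniq q_sub pl.
exists q => //; split=> //; apply/eqP; rewrite eqn_leq dist_le_plen // andbT -pl.
rewrite /plen; case/andP: q_uniq => _ q_uniq.
(* [q] has distinct vertices, all from [p], so its length is a partial sum of that of [p] without
   repetitions. *)
rewrite [X in X <= _](perm_big [seq y <- undup p | y \in q]); last first.
  apply: uniq_perm => //; first by rewrite filter_uniq ?undup_uniq.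
  move=> u; rewrite mem_filter mem_undup.
  by case uq: (u \in q) => //=; rewrite (q_sub u uq).
rewrite big_filter big_mkcond /=.
apply: (@leq_trans (\sum_(u <- undup p) len u)).
  by apply: leq_sum => u _; case: ifP.
elim: p {q_sub pl qP} => //= u p IH; rewrite big_cons; case: ifP => _.
  exact: leq_trans IH (leq_addl _ _).
by rewrite big_cons leq_add2l.
Qed.

Lemma geodesic_catl x p q : geodesic x (p ++ q) -> geodesic x p.
Proof.
case; rewrite cat_path last_cat plen_cat => /andP[pP qP].
rewrite -cat_cons cat_uniq => /and3P[pu _ _] pql; split=> //.
have := dist_triangle (last x p) x (last (last x p) q).
by have := dist_le_plen pP; have := dist_le_plen qP; lia.
Qed.

Lemma geodesic_cat x p q : geodesic x (p ++ q) ->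
  dist x (last x p) + dist (last x p) (last x (p ++ q)) = dist x (last x (p ++ q)).
Proof.
case; rewrite cat_path last_cat plen_cat => /andP[pP qP] _ pql.
have := dist_triangle (last x p) x (last (last x p) q).
by have := dist_le_plen pP; have := dist_le_plen qP; lia.
Qed.

Lemma geodesic_via x p y : geodesic x p -> y \in x :: p ->
  dist x y + dist y (last x p) = dist x (last x p).
Proof. by move=> + yp; case/splitPl: yp => {}p q <-; exact: geodesic_cat. Qed.

(** Additivity along the path settles the case where [y] precedes [z]; in the other order it forces
    [dist z y] to vanish, so [y = z]. *)
Lemma geodesic_between x p y z : geodesic x p -> y \in x :: p -> z \in x :: p ->
  dist x y <= dist x z -> dist x y + dist y z = dist x z.
Proof.
move=> + yp; case/splitPl: yp => {p} p q py.
move=> pqG; rewrite -cat_cons mem_cat => /orP[zp|zq] yz.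
  have := geodesic_via (geodesic_catl pqG) zp; rewrite py.
  have [->|/dist_neq] := eqVneq z y; first by rewrite distxx; lia.
  lia.
case/path.splitP: zq pqG => q1 q2; rewrite catA => /geodesic_catl pqG.
have := @geodesic_via _ _ y pqG; rewrite last_cat last_rcons; apply.
by rewrite -cat_cons mem_cat -py mem_last.
Qed.

Lemma geodesic_gap x p y z : geodesic x p -> y \in x :: p -> z \in x :: p ->
  y != z -> dist x y <= dist x z -> dist x y + 6 <= dist x z.
Proof.
move=> pG yp zp /dist_neq yz le_yz.
by have := geodesic_between pG yp zp le_yz; lia.
Qed.

Lemma geodesic_inj x p : geodesic x p -> {in x :: p &, injective (dist x)}.
Proof.
move=> pG y z yp zp yz; apply/eqP/negPn/negP => /(geodesic_gap pG yp zp).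
by rewrite yz => /(_ (leqnn _)); lia.
Qed.

(* Distinct vertices of a geodesic are at least 6 apart, so that four of them
   span at least 18 > 14. *)
Lemma geodesic_window x p (A : {set T}) : geodesic x p ->
  {subset A <= x :: p} ->
  (forall y z, y \in A -> z \in A -> dist x y <= dist x z + 14) -> #|A| <= 3.
Proof.
move=> pG Ap Aw; have [->|[a0 a0A]] := set_0Vmem A; first by rewrite cards0.
pose a := [arg min_(y < a0 in A) dist x y].
have [aA amin] : a \in A /\ forall y, y \in A -> dist x a <= dist x y.
  by rewrite /a; case: arg_minnP.
pose f y : 'I_3 := inord ((dist x y - dist x a) %/ 6).
have fE y : y \in A -> f y = (dist x y - dist x a) %/ 6 :> nat.
  by move=> yA; rewrite inordK //; have := Aw y a yA aA; have := amin y yA; lia.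
rewrite -(card_in_imset (f := f)); first by rewrite -[X in _ <= X]card_ord max_card.
have key y z : y \in A -> z \in A -> f y = f z -> dist x y <= dist x z -> y = z.
  move=> yA zA fyz le_yz; apply/eqP/negPn/negP.
  move=> /(geodesic_gap pG (Ap y yA) (Ap z zA)) /(_ le_yz).
  have := congr1 (@nat_of_ord 3) fyz; rewrite !fE //.
  by have := amin y yA; have := amin z zA; lia.
move=> y z yA zA fyz; case/orP: (leq_total (dist x y) (dist x z)) => h.
  exact: key.
by symmetry; apply: key.
Qed.

End WeightedDistance.

(** * Centers of the weighted metric and disjoint geodesics *)

Section Center.

Variables (T : finType) (e : rel T).
Hypotheses (e_sym : symmetric e) (e_irr : irreflexive e).
Hypothesis e_conn : connected_graph e.

Local Notation dist := (dist e_conn).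
Local Notation geodesic := (geodesic e_conn).

Definition outer (A : {set T}) : {set T} :=
  [set z | (z \notin A) && [exists y in A, e y z]].

Lemma outerP (A : {set T}) z :
  reflect (z \notin A /\ exists2 y, y \in A & e y z) (z \in outer A).
Proof.
rewrite inE; apply: (iffP andP) => -[zA].
  by case/exists_inP=> y yA yz; split=> //; exists y.
by case=> y yA yz; split=> //; apply/exists_inP; exists y.
Qed.

Lemma closed_neighborsE z y : (y \in closed_neighbors e z) = (y == z) || e z y.
Proof. by rewrite !inE. Qed.

Lemma card_closed_neighbors z : #|closed_neighbors e z| = (deg e z).+1.
Proof. by rewrite cardsU1 /deg inE e_irr. Qed.

Lemma dist_closed_neighbors z x y :
  x \in closed_neighbors e z -> y \in closed_neighbors e z -> dist x y <= 14.
Proof.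
have half u v : (u == v) || e u v -> dist u v <= 7.
  by case/orP=> [/eqP->|/dist_edge]; rewrite ?distxx.
rewrite !closed_neighborsE => xz yz.
apply: leq_trans (dist_triangle e_conn z x y) _.
by rewrite (@leq_add _ _ 7 7) ?half // ?(eq_sym y) // ?(e_sym x) // eq_sym.
Qed.

(** Two closed neighbors of [z] are at most 14 apart, which leaves room for only three on a
    geodesic. *)
Lemma card_geodesic_closed_neighbors x p z : geodesic x p ->
  #|[set y in x :: p] :&: closed_neighbors e z| <= 3.
Proof.
move=> pG; apply: (geodesic_window pG) => [y|y y']; first by rewrite !inE => /andP[].
rewrite !finset.in_setI => /andP[_ yz] /andP[_ y'z].
apply: leq_trans (dist_triangle e_conn y' x y) _.
by rewrite leq_add2l (dist_closed_neighbors (z := z)).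
Qed.

(** Double counting: a vertex of degree at least 3 has four closed neighbors, at most three of them
    on the geodesic, hence a neighbor in [outer A]; a vertex of [outer A] in turn sees at most three
    vertices of the geodesic. *)
Lemma card_big_deg_outer x p (A : {set T}) : geodesic x p ->
  {subset A <= x :: p} -> #|[set y in A | big_deg e y]| <= 3 * #|outer A|.
Proof.
move=> pG Ap.
have has_outer y : y \in A -> big_deg e y -> exists2 z, z \in outer A & e y z.
  move=> yA yb.
  have : ~~ (closed_neighbors e y \subset [set u in x :: p]).
    apply/negP => /finset.setIidPr yp.
    have := card_geodesic_closed_neighbors y pG.
    by rewrite yp card_closed_neighbors; move: yb; rewrite /big_deg; lia.
  case/subsetPn=> z; rewrite closed_neighborsE inE => zy zp.
  have yz : e y z by case/orP: zy => // /eqP zy; rewrite zy Ap in zp.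
  exists z => //; apply/outerP; split; last by exists y.
  by apply: contra zp => /Ap.
rewrite -sum1_card.
apply: (@leq_trans (\sum_(y in [set y in A | big_deg e y])
                     \sum_(z in outer A | e y z) 1)).
  apply: leq_sum => y; rewrite inE => /andP[yA /(has_outer _ yA)[z zA yz]].
  by rewrite (bigD1 z) ?zA.
rewrite (exchange_big_dep (mem (outer A))) /=; last by move=> y z _ /andP[].
rewrite mulnC -sum_nat_const; apply: leq_sum => z zA.
rewrite sum1dep_card; apply: leq_trans (card_geodesic_closed_neighbors z pG).
apply/subset_leq_card/fintype.subsetP => y.
rewrite finset.in_set => /and3P[]; rewrite finset.in_set => /andP[yA _] _ yz.
by rewrite finset.in_setI closed_neighborsE finset.in_set Ap // e_sym yz orbT.
Qed.

Lemma sum_len (A : {set T}) :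
  \sum_(y in A) len e y = 6 * #|A| + #|[set y in A | big_deg e y]|.
Proof.
rewrite big_split /= sum_nat_const mulnC; congr (_ + _).
rewrite -sum1_card [RHS]big_mkcond [LHS]big_mkcond /=.
by apply: eq_bigr => y _; rewrite inE; case: (y \in A); case: big_deg.
Qed.

Lemma sum_len_geodesic x p : geodesic x p ->
  \sum_(y in [set y in x :: p]) len e y = len e x + dist x (last x p).
Proof.
case=> _ p_uniq <-; rewrite (eq_bigl (mem (x :: p))); last by move=> y; rewrite inE.
by rewrite -big_uniq //= big_cons.
Qed.

Lemma card_geodesic x p : geodesic x p ->
  6 * #|[set y in x :: p]| + #|[set y in [set y in x :: p] | big_deg e y]|
    <= dist x (last x p) + 7.
Proof.
move=> pG; rewrite -sum_len sum_len_geodesic // addnC leq_add2l.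
by case/andP: (len_bounds e x).
Qed.

(** Geodesics from the center have overlapping neighborhoods near it. The cutoff is [49 = 35 + 14]:
    a vertex farther out shares no closed neighbor with one within 35 of the center. *)
Definition far (x : T) (p : seq T) : {set T} := [set y in x :: p | 49 < dist x y].

Lemma dist_far x p : geodesic x p ->
  dist x (last x p) <= 6 * #|far x p| + #|[set y in far x p | big_deg e y]| + 350.
Proof.
move=> pG.
have := sum_len_geodesic pG; rewrite (bigID (mem (far x p))) /=.
rewrite (eq_bigl (mem (far x p))); last first.
  by move=> y; rewrite !inE; case: (_ || _).
rewrite sum_len.
set near := \sum_(_ in _ | _) _; suff: near <= 350 by lia.
(* [dist x] is injective on the geodesic, so at most 50 of its vertices are within 49, each charged
   at most 7. *)
pose N := [set y in x :: p | dist x y < 50].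
have : near <= \sum_(y in N) 7.
  rewrite /near (eq_bigl (mem N)); last first.
    by move=> y; rewrite !inE; case: orb => //=; rewrite -leqNgt.
  by apply: leq_sum => y _; case/andP: (len_bounds e y).
rewrite sum_nat_const; suff: #|N| <= 50 by lia.
pose f y : 'I_50 := inord (dist x y).
rewrite -(card_in_imset (f := f)); first by rewrite -[X in _ <= X]card_ord max_card.
move=> y z; rewrite inE => /andP[yp yN]; rewrite inE => /andP[zp zN].
move/(congr1 (@nat_of_ord 50)); rewrite !inordK // => yz.
exact: (geodesic_inj pG).
Qed.

Definition closed_nbhd (A : {set T}) : {set T} := A :|: outer A.

Lemma closed_nbhdP (A : {set T}) z :
  z \in closed_nbhd A -> exists2 y, y \in A & y \in closed_neighbors e z.
Proof.
rewrite inE => /orP[zA|/outerP[_ [y yA yz]]].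
  by exists z; rewrite // closed_neighborsE eqxx.
by exists y; rewrite // closed_neighborsE e_sym yz orbT.
Qed.

Lemma card_closed_nbhd (A : {set T}) : #|closed_nbhd A| = #|A| + #|outer A|.
Proof.
rewrite cardsU (_ : A :&: outer A = finset.set0) ?cards0 ?subn0 //.
by apply/setP=> z; rewrite !inE; case: (z \in A).
Qed.

Definition ecc (x : T) : nat := \max_y dist x y.

Lemma dist_le_ecc x y : dist x y <= ecc x.
Proof. exact: (leq_bigmax y). Qed.

Lemma ecc_attained x : exists y, ecc x = dist x y.
Proof.
have T0 : 0 < #|T| by apply/card_gt0P; exists x.
by have [y yE] := @bigop.eq_bigmax T (dist x) T0; exists y.
Qed.

(* Moving the centre a few steps along [p] does not lower the eccentricity, so
   some point is still far away, and a geodesic to it avoids the neighborhood of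
   [p], since otherwise it would be reached faster through [p].  The thresholds
   come from the bound 14 on the distance between two vertices having a common
   closed neighbor and from the bound 7 on the distance between neighbors. *)
Lemma center_opposite r p : (forall x, ecc r <= ecc x) -> geodesic r p ->
  exists q, [/\ geodesic r q, ecc r <= dist r (last r q) + 42
    & [disjoint closed_nbhd [set y in r :: p] & closed_nbhd (far r q)]].
Proof.
move=> r_center pG.
have reduce b : (exists2 x, x \in r :: p & [/\ dist r x <= 35, ecc r <= dist x b
    & (x = r /\ forall z, z \in r :: p -> dist r z <= 35) \/ 28 < dist r x]) ->
  exists q, [/\ geodesic r q, ecc r <= dist r (last r q) + 42
    & [disjoint closed_nbhd [set y in r :: p] & closed_nbhd (far r q)]].
  case=> x xp [x35 xb xfar]; have [q qG qb] := ex_geodesic e_conn r b.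
  exists q; split=> //.
    rewrite qb; have := dist_triangle e_conn r x b.
    by have := dist_rev e_sym e_conn r x; lia.
  apply/pred0P => u /=; apply/negP => /andP[].
  move=> /closed_nbhdP[z + zu] /closed_nbhdP[y + yu].
  rewrite !inE -!in_cons => zp /andP[yq y49].
  have zy : dist z y <= 14 by apply: dist_closed_neighbors zu yu.
  have yz : dist y z <= 14 by apply: dist_closed_neighbors yu zu.
  have := dist_triangle e_conn z r y; have := dist_triangle e_conn y r z.
  case: xfar => [[_ /(_ z zp)]|x28]; first lia.
  have [zx|xz] := ltnP (dist r z) (dist r x); first lia.
  (* Going from [x] to [b] through [z] and [y] gives [dist x b <= dist r b - dist r x + 28], which
     is below [dist r b] and hence below [ecc r]. *)
  have := geodesic_between pG xp zp xz; have := geodesic_via qG yq; rewrite qb.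
  have := dist_triangle e_conn z x b; have := dist_triangle e_conn y z b.
  have := dist_le_ecc r b; lia.
have [/hasP[x xp x28]|/hasPn near] :=
    boolP (has (fun x => 28 < dist r x <= 35) (r :: p)).
  have [b xb] := ecc_attained x; apply: (reduce b); exists x => //.
  by case/andP: x28 => x28 x35; rewrite -xb; split=> //; right.
have [b rb] := ecc_attained r; apply: (reduce b); exists r; first exact: mem_head.
rewrite rb distxx; split=> //; left; split=> // z zp.
rewrite leqNgt; apply/negP => z35.
(* An edge costs at most 7, so no step can jump over the window from 29 to 35. *)
have near_path s p' : path e s p' -> dist r s <= 28 ->
    {subset p' <= r :: p} -> {in p', forall u, dist r u <= 28}.
  elim: p' s => //= y p' IH s /andP[sy yP] s28 sub.
  have y28 : dist r y <= 28.
    have := near y (sub y (mem_head _ _)); have := dist_edge e_conn sy.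
    by have := dist_triangle e_conn s r y; lia.
  move=> u; rewrite inE => /predU1P[->//|up]; apply: (IH y) up => // w wp.
  by apply: sub; rewrite inE wp orbT.
case: pG => pP _ _; have := near_path _ _ pP; rewrite distxx => /(_ isT).
have sub : {subset p <= r :: p} by move=> u up; rewrite inE up orbT.
move: zp; rewrite inE => /predU1P[zr|zp /(_ sub z zp)]; last lia.
by move: z35; rewrite zr distxx.
Qed.

(** Keep 30 of the weight of each vertex of [P]. The rest, with the bonuses, is about
    [5 * dist r v]; even after adding the gap to [ecc r] it is at most [5 * ecc r], hence about 30
    per vertex of [far r q] and 15 per outer neighbor of these. Setting aside one unit per vertex of
    [P] and [far r q] pays, within [#|T|], for counting the remaining vertices, and leaves at most
    29 per vertex. *)
Lemma center_cost : 0 < #|T| -> exists r, forall v,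
  dist r v <= ecc r /\ exists p q, [/\ geodesic r p, geodesic r q, last r p = v
  & let P := [set y in r :: p] in
    60 * #|P| + 29 * #|outer P| + 5 * #|[set y in P | big_deg e y]| + 180
      + #|~: (P :|: [set y in r :: q])| + (ecc r - dist r v)
      <= 30 * #|T| + 2175].
Proof.
case/card_gt0P=> x0 _; exists [arg min_(x < x0) ecc x] => v.
case: arg_minnP => // r _ r_min; split; first exact: dist_le_ecc.
have [p pG pv] := ex_geodesic e_conn r v.
have [|q [qG rq dis]] := center_opposite _ pG; first by move=> x; apply: r_min.
exists p, q; split=> //=.
set P := [set y in r :: p]; set Q := far r q in dis.
have : #|closed_nbhd P| + #|closed_nbhd Q| <= #|T|.
  rewrite -(cardsT T) -(_ : #|closed_nbhd P :|: closed_nbhd Q| = _ + _).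
    by rewrite subset_leq_card ?finset.subsetT.
  rewrite cardsU (_ : _ :&: _ = finset.set0) ?cards0 ?subn0 //.
  by apply/eqP; rewrite setI_eq0.
have : #|~: (P :|: [set y in r :: q])| + #|P| + #|Q| <= #|T|.
  rewrite -(cardsC (P :|: [set y in r :: q])) -addnA addnC leq_add2r.
  have <- : #|P :|: Q| = #|P| + #|Q|.
    rewrite cardsU (_ : _ :&: _ = finset.set0) ?cards0 ?subn0 //.
    apply/eqP; rewrite setI_eq0; apply: disjointWl (disjointWr _ dis);
      exact: finset.subsetUl.
  apply/subset_leq_card/finset.setUS/fintype.subsetP => y.
  by rewrite !inE => /andP[].
(* The constant is [2175 = 5 * (7 + 42 + 350) + 180], from [card_geodesic], [center_opposite],
   [dist_far] and the bonus at [r]. *)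
have := card_geodesic pG; rewrite -/P pv !card_closed_nbhd.
have := dist_far qG; rewrite -/Q.
have /(card_big_deg_outer qG) : {subset Q <= r :: q} by move=> y; rewrite inE => /andP[].
have := dist_le_ecc r v; move: rq.
set Dq := dist r (last r q); set Dv := dist r v; set R := ecc r.
move: #|~: _| #|P| #|outer P| #|Q| #|outer Q| #|T|.
move: #|[set y in P | _]| #|[set y in Q | _]| Dq Dv R.
by move=> *; lia.
Qed.

End Center.

Local Open Scope ring_scope.

(** * Geometric sums *)

Section GeometricSums.

Variables (R : realFieldType) (t : R).
Hypotheses (t_gt0 : 0 < t) (t_lt1 : t < 1).

Lemma geometric_sum_le k : \sum_(j < k) t ^+ j <= (1 - t)^-1.
Proof.
have t1 : 0 < 1 - t by rewrite subr_gt0.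
rewrite -(ler_pM2l t1) mulfV ?gt_eqF // -[X in X * _]opprB mulNr -subrX1 opprB.
by rewrite lerBlDr lerDl exprn_ge0 // ltW.
Qed.

Lemma mulrn_expr_le k : k%:R * t ^+ k <= (1 - t)^-1.
Proof.
apply: le_trans (geometric_sum_le k).
rewrite -[X in X%:R](card_ord k) mulr_natl -sumr_const; apply: ler_sum => j _.
by rewrite ler_wiXn2l ?ltW // ltnW.
Qed.

Lemma sum_expr_inj_le (T : finType) (A : {set T}) (f : T -> nat) :
  {in A &, injective f} -> \sum_(v in A) t ^+ f v <= (1 - t)^-1.
Proof.
move=> f_inj; pose N := (\max_v f v).+1.
have f_lt v : (f v < N)%N by rewrite ltnS; exact: (leq_bigmax v).
pose g v : 'I_N := Ordinal (f_lt v).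
have g_inj : {in A &, injective g}.
  by move=> u v uA vA /(congr1 (@nat_of_ord N)); apply: f_inj.
rewrite -(big_imset (fun j : 'I_N => t ^+ j) g_inj) /=.
apply: le_trans (geometric_sum_le N).
rewrite [leRHS](bigID (mem (g @: A))) /= lerDl sumr_ge0 // => j _.
by rewrite exprn_ge0 // ltW.
Qed.

End GeometricSums.

(** * Summing the initial potentials over all targets *)

Section CenterSum.

Variables (T : finType) (e : rel T).
Hypotheses (e_sym : symmetric e) (e_irr : irreflexive e).
Hypothesis e_conn : connected_graph e.

Definition initial_cost (P : {set T}) : nat :=
  60 * #|P| + 29 * #|outer e P| + 5 * #|[set y in P | big_deg e y]| + 180.

(* Besides the vertices of the two geodesics attached to a vertex [v0] of
   maximal cost, the number of vertices is at most the slack in the cost of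
   [v0], while along these geodesics the slack increases with the distance to
   the far end: both kinds of terms are summable. *)
Lemma sum_initial_cost (R : realFieldType) (t : R) : 0 < t -> t < 1 ->
  (0 < #|T|)%N -> exists r, exists2 p : T -> seq T,
    forall v, path e r (p v) /\ last r (p v) = v
  & \sum_v t ^- initial_cost [set y in r :: p v]
      <= 3 / (1 - t) * t ^- (30 * #|T| + 2175).
Proof.
move=> t_gt0 t_lt1 T_gt0; have [r rP] := center_cost e_sym e_irr e_conn T_gt0.
exists r.
have /boolp.choice[pq /all_and2[rv pqP]] : forall v, exists pq : seq T * seq T,
    (dist e_conn r v <= ecc e_conn r)%N /\
    [/\ geodesic e_conn r pq.1, geodesic e_conn r pq.2,
      last r pq.1 = v &
      (initial_cost [set y in r :: pq.1]
        + #|~: ([set y in r :: pq.1] :|: [set y in r :: pq.2])|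
        + (ecc e_conn r - dist e_conn r v) <= 30 * #|T| + 2175)%N].
  by move=> v; have [rv [p [q H]]] := rP v; exists (p, q).
exists (fun v => (pq v).1) => [v|].
  by have [[pG _ _] _ pv _] := pqP v.
pose V v := initial_cost [set y in r :: (pq v).1].
rewrite -/(V _); set M := (30 * _ + _)%N in pqP *.
have VM v : (V v <= M)%N by have [_ _ _] := pqP v; rewrite -/(V v); lia.
suff sumV : \sum_v t ^+ (M - V v) <= 3 / (1 - t).
  apply: (@le_trans _ _ ((\sum_v t ^+ (M - V v)) * t ^- M)).
    rewrite mulr_suml; apply: ler_sum => v _; rewrite -/(V v).
    rewrite -[in t ^- M](subnK (VM v)) exprD invfM mulrA mulfV ?mul1r //.
    by rewrite expf_neq0 // gt_eqF.
  by rewrite ler_pM2r // invr_gt0 exprn_gt0.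
have [x0 _] : exists x0 : T, x0 \in T by apply/card_gt0P.
pose v0 := [arg max_(v > x0) V v].
have V_max v : (V v <= V v0)%N.
  by rewrite /v0; case: arg_maxnP => // u _ /(_ v isT).
have [pG qG _ v0M] := pqP v0.
set P := [set y in r :: (pq v0).1] in v0M; set Q := [set y in r :: (pq v0).2] in v0M.
have geo q : geodesic e_conn r q ->
    \sum_(v in [set y in r :: q]) t ^+ (M - V v) <= (1 - t)^-1.
  move=> geo_q; apply: le_trans (sum_expr_inj_le t_gt0 t_lt1
    (A := [set y in r :: q]) (f := fun v => (ecc e_conn r - dist e_conn r v)%N) _).
    apply: ler_sum => v _; rewrite ler_wiXn2l ?ltW //.
    by have [_ _ _] := pqP v; rewrite -/(V v); lia.
  move=> u v; rewrite !finset.in_set => uq vq uv; apply: (geodesic_inj geo_q) => //.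
  (* The truncated subtraction is injective because no distance from [r] exceeds [ecc r]. *)
  by have := rv u; have := rv v; lia.
have rest : \sum_(v in ~: (P :|: Q)) t ^+ (M - V v) <= (1 - t)^-1.
  apply: le_trans (mulrn_expr_le t_gt0 t_lt1 #|~: (P :|: Q)|).
  rewrite mulr_natl -sumr_const; apply: ler_sum => v _; rewrite ler_wiXn2l ?ltW //.
  by have := V_max v; move: v0M; rewrite -/(V v0); lia.
have -> : 3 / (1 - t) = (1 - t)^-1 + (1 - t)^-1 + (1 - t)^-1 :> R by ring.
apply: le_trans (lerD (lerD (geo _ pG) (geo _ qG)) rest).
rewrite -/P -/Q (big_mkcond (fun v => v \in P)) (big_mkcond (fun v => v \in Q)).
rewrite (big_mkcond (fun v => v \in ~: _)) -!big_split /=; apply: ler_sum => v _.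
have : 0 <= t ^+ (M - V v) by rewrite exprn_ge0 // ltW.
rewrite finset.in_setC finset.in_setU.
by case: (v \in P); case: (v \in Q); rewrite /= ?addr0 ?add0r //; lra.
Qed.

End CenterSum.

(** * One step of the process *)

(** The bound [p (1 + s) <= 1] survives multiplying the [p] and adding the [s], as
    [1 + s + s' <= (1 + s) (1 + s')]. It reduces a mean over independent attempts to the mean total
    drop. *)
Lemma prod_1subr_le (R : realFieldType) (I : finType) (A : {set I}) (y : I -> R) :
  (forall i, i \in A -> 0 <= y i <= 1) ->
  \prod_(i in A) (1 - y i) <= (1 + \sum_(i in A) y i)^-1.
Proof.
move=> y01.
suff : 0 <= \prod_(i in A) (1 - y i) /\ 0 <= \sum_(i in A) y i /\
    \prod_(i in A) (1 - y i) * (1 + \sum_(i in A) y i) <= 1.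
  case=> [_ [s0]]; have s1 : 0 < 1 + \sum_(i in A) y i by lra.
  by rewrite -ler_pdivlMr // mul1r.
apply: (big_ind2 (fun p s => 0 <= p /\ 0 <= s /\ p * (1 + s) <= 1)).
- by lra.
- move=> p s p' s' [p0 [s0 ps]] [p'0 [s'0 p's']].
  have pp'0 : 0 <= p * p' by rewrite mulr_ge0.
  split=> //; split; first by rewrite addr_ge0.
  have : (p * (1 + s)) * (p' * (1 + s')) <= 1.
    by apply: mulr_ile1; rewrite // mulr_ge0 // addr_ge0.
  apply: le_trans; rewrite [leRHS](_ : _ = p * p' * ((1 + s) * (1 + s'))); last by ring.
  by apply: ler_wpM2l => //; have := mulr_ge0 s0 s'0; lra.
- by move=> i /y01/andP[y0 y1]; split; [lra | split; nra].
Qed.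

Section OneStep.

Variables (R : realType) (T : finType) (e : rel T).
Hypothesis e_irr : irreflexive e.

Implicit Types (B C : {set T}) (A : {set T * T}).

Definition expect B (phi : {set T} -> R) : R := \sum_C step_prob R e B C * phi C.

Lemma expectE B phi : expect B phi =
  \sum_(A : {set T * T} | A \subset attempts e B)
    success_prob R e B A * phi (B :|: [set p.2 | p in A]).
Proof.
rewrite /expect /step_prob; under eq_bigr => C _ do rewrite mulr_suml.
rewrite (exchange_big_dep (fun A => A \subset attempts e B)) /=; last first.
  by move=> C A _ /andP[].
apply: eq_bigr => A AB; rewrite (bigD1 (B :|: [set p.2 | p in A])) ?AB ?eqxx //=.
rewrite big1 ?addr0 // => C /andP[/eqP <-].
by rewrite eqxx.
Qed.

(** Independence: the mean of the product factors, an attempt contributing [g p] if it succeeds and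
    1 otherwise. *)
Lemma sum_success_prod B (g : T * T -> R) :
  \sum_(A : {set T * T} | A \subset attempts e B)
    success_prob R e B A * \prod_(p in A) g p
  = \prod_(p in attempts e B) (1 - force_prob R e B p.1 * (1 - g p)).
Proof.
set E := attempts e B; pose f (p : T * T) : R := force_prob R e B p.1.
(* Outside [E], [F] is 0 and [G] is 1, so expanding the product over all pairs leaves only the
   subsets of [E]. *)
pose F (p : T * T) := if p \in E then f p * g p else 0.
pose G (p : T * T) := if p \in E then 1 - f p else 1.
have -> : \prod_(p in E) (1 - f p * (1 - g p)) = \prod_p (F p + G p).
  rewrite big_mkcond; apply: eq_bigr => p _; rewrite /F /G.
  by case: (p \in E); ring.
rewrite bigA_distr [RHS](bigID (fun A => A \subset E)) /= [X in _ + X]big1 ?addr0.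
  apply: eq_bigr => A AE; rewrite /success_prob -/E.
  rewrite (big_mkcond (mem A)) /= (big_mkcond (mem E)) -big_split /=.
  apply: eq_bigr => p _; rewrite /F /G -/(f p).
  case pA: (p \in A); first by rewrite (fintype.subsetP AE) // pA.
  by case: ifP; rewrite ?pA mulr1.
move=> A /fintype.subsetPn[p pA pE].
by rewrite (bigD1 p) //= pA /F (negbTE pE) mul0r.
Qed.

Lemma prod_from (E : {set T * T}) u (X : T -> R) :
  \prod_(p in E) (if p.1 == u then X p.2 else 1) = \prod_(z | (u, z) \in E) X z.
Proof.
rewrite big_mkcond [RHS]big_mkcond /=.
rewrite (eq_bigr (fun p => (fun x z => if (x, z) \in E then
  if x == u then X z else 1 else 1) p.1 p.2)); last by case.
rewrite -(pair_bigA _ (fun x z => if (x, z) \in E then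
  if x == u then X z else 1 else 1)) /= (bigD1 u) //= eqxx [X in _ * X]big1 ?mulr1 //.
by move=> x /negbTE ->; rewrite big1 // => z _; rewrite if_same.
Qed.

Lemma sum_success_from B u (g : T -> R) : u \in B ->
  \sum_(A : {set T * T} | A \subset attempts e B)
    success_prob R e B A * \prod_(z | (u, z) \in A) g z
  = \prod_(z in neighbors e u :\: B) (1 - force_prob R e B u * (1 - g z)).
Proof.
move=> uB; pose h (p : T * T) := if p.1 == u then g p.2 else 1.
transitivity (\sum_(A : {set T * T} | A \subset attempts e B)
    success_prob R e B A * \prod_(p in A) h p).
  by apply: eq_bigr => A _; rewrite -prod_from.
rewrite sum_success_prod.
transitivity (\prod_(p in attempts e B)
    (if p.1 == u then 1 - force_prob R e B u * (1 - g p.2) else 1)).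
  apply: eq_bigr => p _; rewrite /h.
  by case: eqP => [->|_]; rewrite ?subrr ?mulr0 ?subr0.
rewrite (prod_from _ _ (fun z => 1 - force_prob R e B u * (1 - g z))).
by apply: eq_bigl => z; rewrite !inE /= uB.
Qed.

Lemma closed_neighbors_split B u : u \in B ->
  (#|closed_neighbors e u :&: B| + #|neighbors e u :\: B| = (deg e u).+1)%N.
Proof.
move=> uB; rewrite -(card_closed_neighbors e_irr).
rewrite -(cardsID B (closed_neighbors e u)); congr (_ + _)%N.
apply: eq_card => z; rewrite !inE.
by case: eqP => // ->; rewrite uB.
Qed.

(** A white neighbor keeps the number of blue closed neighbors at most [deg e u]; without one the
    quotient would be [(deg e u + 1) / deg e u]. *)
Lemma force_prob_bounds B u : u \in B -> neighbors e u :\: B != finset.set0 ->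
  0 <= force_prob R e B u <= 1.
Proof.
move=> uB; rewrite -card_gt0 => w0; have := closed_neighbors_split uB => bw.
have d0 : (0 < (deg e u)%:R :> R).
  have : (0 < #|closed_neighbors e u :&: B|)%N.
    by apply/card_gt0P; exists u; rewrite !inE eqxx.
  by rewrite ltr0n; lia.
rewrite /force_prob divr_ge0 ?ler0n //= ler_pdivrMr // mul1r ler_nat; lia.
Qed.

Lemma success_prob_ge0 B A : 0 <= success_prob R e B A.
Proof.
apply: prodr_ge0 => -[u z]; rewrite inE /= => /and3P[uB zB uz].
have /force_prob_bounds : neighbors e u :\: B != finset.set0.
  by apply/finset.set0Pn; exists z; rewrite !inE zB.
by move=> /(_ uB)/andP[f0 f1]; case: ifP => _; rewrite ?subr_ge0.
Qed.

Lemma step_prob_ge0 B C : 0 <= step_prob R e B C.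
Proof. by apply: sumr_ge0 => A _; apply: success_prob_ge0. Qed.

Lemma sum_step_prob B : \sum_C step_prob R e B C = 1.
Proof.
have := expectE B (fun=> 1); rewrite /expect; under eq_bigr do rewrite mulr1.
move=> ->; transitivity (\prod_(p in attempts e B)
    (1 - force_prob R e B p.1 * (1 - (fun=> 1) p))).
  by rewrite -sum_success_prod; apply: eq_bigr => A _; rewrite big1_eq.
by rewrite big1 // => p _; rewrite subrr mulr0 subr0.
Qed.

End OneStep.

Local Open Scope nat_scope.

(** * The weight of the white vertices *)

Section Cost.

Variables (T : finType) (e : rel T) (P : {set T}) (r : T).

Definition slow (B : {set T}) : {set T} :=
  [set x in P | big_deg e x && (#|closed_neighbors e x :&: B| <= 2)].

Definition cost (B : {set T}) : nat :=
  60 * #|P :\: B| + 29 * #|outer e P :\: B| + 5 * #|slow B|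
    + 180 * (#|closed_neighbors e r :&: B| <= 1).

Lemma cost_le_initial (B : {set T}) : cost B <= initial_cost e P.
Proof.
rewrite /cost /initial_cost.
have := subset_leq_card (finset.subsetDl P B).
have := subset_leq_card (finset.subsetDl (outer e P) B).
have : #|slow B| <= #|[set y in P | big_deg e y]|.
  apply/subset_leq_card/fintype.subsetP => x.
  by rewrite !finset.in_set => /and3P[-> ->].
by case: leqP; lia.
Qed.

Lemma card_setD_decr (X B C F : {set T}) : B \subset C -> F \subset C ->
  [disjoint F & B] -> #|X :\: C| + #|X :&: F| <= #|X :\: B|.
Proof.
move=> BC FC FB.
have <- : #|(X :\: C) :|: (X :&: F)| = #|X :\: C| + #|X :&: F|.
  rewrite cardsU (_ : (X :\: C) :&: _ = finset.set0) ?cards0 ?subn0 //.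
  apply/finset.setP=> z; rewrite !inE; case zF: (z \in F); rewrite ?andbF //.
  by rewrite (fintype.subsetP FC).
apply/subset_leq_card/fintype.subsetP => z; rewrite !inE.
case/orP=> /andP[]; first by move=> zC ->; rewrite (contra (fintype.subsetP BC z)).
by move=> -> zF; rewrite (disjointFr FB).
Qed.

(** [F] will be the set of vertices forced by [u]. As [u] lies in [P], each of them weighs 29 or 60,
    and [y] weighs [60 = 29 + 31]. If [F] is nonempty, [u] gains a blue closed neighbor and passes
    the threshold at which its bonus is lost; no other term increases. *)
Lemma cost_decr (B C F : {set T}) (u y : T) : B \subset C -> F \subset C ->
  F \subset neighbors e u :\: B -> u \in P -> u \in B -> y \in P ->
  cost C + (31 * (y \in F) + 29 * #|F|)
    + (0 < #|F|) * (5 * (big_deg e u && (#|closed_neighbors e u :&: B| == 2))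
                    + 180 * ((u == r) && (#|closed_neighbors e u :&: B| <= 1)))
  <= cost B.
Proof.
move=> BC FC FW uP uB yP.
have FB : [disjoint F & B].
  apply/pred0P => z /=; apply/negP => /andP[/(fintype.subsetP FW)].
  by rewrite inE => /andP[/negP].
have grow x : #|closed_neighbors e x :&: B| <= #|closed_neighbors e x :&: C|.
  by apply/subset_leq_card/finset.setIS.
have growu : 0 < #|F| ->
    #|closed_neighbors e u :&: B| < #|closed_neighbors e u :&: C|.
  case/card_gt0P=> z zF; apply/proper_card/properP; split; first exact: finset.setIS.
  have := fintype.subsetP FW z zF; rewrite !inE => /andP[zB ez].
  by exists z; rewrite !inE ?(negbTE zB) ?andbF // ez orbT (fintype.subsetP FC).
have cP := card_setD_decr P BC FC FB.
have cO := card_setD_decr (outer e P) BC FC FB.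
have cF : #|F| <= #|P :&: F| + #|outer e P :&: F|.
  apply: leq_trans (leq_card_setU _ _); apply/subset_leq_card/fintype.subsetP => z zF.
  have := fintype.subsetP FW z zF; rewrite !inE => /andP[_ uz].
  rewrite zF !andbT; case: (z \in P) => //=.
  by apply/exists_inP; exists u.
have yF : (y \in F) <= #|P :&: F|.
  by case yF: (y \in F) => //; apply/card_gt0P; exists y; rewrite inE yP.
have cS : #|slow C| + (0 < #|F|) *
    (big_deg e u && (#|closed_neighbors e u :&: B| == 2)) <= #|slow B|.
  have sub : slow C \subset slow B.
    apply/fintype.subsetP => x; rewrite !finset.in_set => /and3P[-> -> xC].
    exact: leq_trans (grow x) xC.
  have := subset_leq_card sub.
  case: (boolP (0 < #|F|)) => [F0|_]; last by rewrite mul0n addn0.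
  case ub: (big_deg e u && _); last by rewrite muln0 addn0.
  move=> _; rewrite mul1n addn1; apply/proper_card/properP; split=> //.
  case/andP: ub => ub u2; exists u; rewrite !finset.in_set uP ub ?(eqP u2) //=.
  by move: (growu F0); rewrite (eqP u2) -ltnNge.
have cR : (#|closed_neighbors e r :&: C| <= 1) + (0 < #|F|) *
    ((u == r) && (#|closed_neighbors e u :&: B| <= 1))
    <= (#|closed_neighbors e r :&: B| <= 1).
  have mono : (#|closed_neighbors e r :&: C| <= 1) <=
      (#|closed_neighbors e r :&: B| <= 1).
    case: (boolP (#|_ :&: C| <= 1)) => // c1.
    by rewrite (leq_trans (grow r) c1).
  case: (boolP (0 < #|F|)) => [/growu gu|_]; last by rewrite mul0n addn0.
  rewrite mul1n; case: eqP gu mono => [<- gu mono|_ _ mono] /=; last by rewrite addn0.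
  case: (boolP (#|closed_neighbors e u :&: B| <= 1)) mono => [b1 _|_ mono].
    case: (boolP (#|_ :&: C| <= 1)) => // c1.
    have b0 : 0 < #|closed_neighbors e u :&: B|.
      by apply/card_gt0P; exists u; rewrite !inE eqxx.
    by have := leq_trans gu c1; lia.
  by rewrite addn0.
rewrite /cost; move: cP cO cF yF cS cR.
move: (_ && _) (_ && _) #|F| #|P :&: F| #|outer e P :&: F|.
move: #|P :\: C| #|P :\: B| #|_ :\: C| #|_ :\: B| #|slow C| #|slow B|.
by move=> *; nia.
Qed.

End Cost.

Local Open Scope ring_scope.

(** * Estimates for powers of [t] near 1 *)

Section Rates.

Variables (R : realFieldType) (t : R).
Hypotheses (t_lt1 : t < 1) (t_near1 : 1 - t <= 1 / 1000 * (1 / 1000)).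

Lemma near1_gt0 : 0 < t.
Proof. by move: t_near1; lra. Qed.

Lemma expr_lb k : 1 - k%:R * (1 - t) <= t ^+ k.
Proof.
elim: k => [|k IH]; first by rewrite mul0r subr0 expr0.
have k0 : 0 <= k%:R :> R by rewrite ler0n.
rewrite exprS; apply: le_trans (ler_wpM2l (ltW near1_gt0) IH).
rewrite -natr1 -subr_ge0 [leRHS](_ : _ = k%:R * (1 - t) ^+ 2); last by ring.
by rewrite mulr_ge0 ?sqr_ge0.
Qed.

Lemma expr_ub k : t ^+ k * (1 + k%:R * (1 - t)) <= 1.
Proof.
elim: k => [|k IH]; first by rewrite mul0r addr0 expr0 mulr1.
apply: le_trans IH; rewrite exprSr -mulrA.
apply: ler_wpM2l; first by rewrite exprn_ge0 // ltW // near1_gt0.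
have k0 : 0 <= k%:R :> R by rewrite ler0n.
rewrite -natr1 -subr_ge0 [leRHS](_ : _ = (k%:R + 1) * (1 - t) ^+ 2); last by ring.
by rewrite mulr_ge0 ?addr_ge0 ?sqr_ge0.
Qed.

(** With [s = 1 - t], use [t ^+ k <= 1 / (1 + k s)]: the product [(1 - c s) (1 + k s)] is at least 1
    once [c k s <= k - c], so [c] may be just below [k]. *)
Lemma expr_le k (c : R) : 0 <= c ->
  c * k%:R * (1 - t) <= k%:R - c -> t ^+ k <= 1 - c * (1 - t).
Proof.
move=> c0 ck; have k0 : 0 <= k%:R :> R by rewrite ler0n.
have s0 : 0 < 1 - t by move: t_lt1; lra.
have p0 : 0 < 1 + k%:R * (1 - t) by nra.
rewrite -(ler_pM2r p0); apply: le_trans (expr_ub k) _.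
by move: s0 ck; set s := 1 - t => s0 ck; nra.
Qed.

Lemma expr60_le : t ^+ 60 <= 1 - 599 / 10 * (1 - t).
Proof. by apply: expr_le; move: t_near1 t_lt1; lra. Qed.

Lemma expr29_le : t ^+ 29 <= 1 - 2899 / 100 * (1 - t).
Proof. by apply: expr_le; move: t_near1 t_lt1; lra. Qed.

Lemma expr5_le : t ^+ 5 <= 1 - 499 / 100 * (1 - t).
Proof. by apply: expr_le; move: t_near1 t_lt1; lra. Qed.

Lemma expr180_le : t ^+ 180 <= 1 - 179 * (1 - t).
Proof. by apply: expr_le; move: t_near1 t_lt1; lra. Qed.

Lemma expr60_ge : 1 - 60 * (1 - t) <= t ^+ 60.
Proof. exact: expr_lb. Qed.

(** Case of one blue closed neighbor: [q] bounds the probability that nothing is forced, and a bonus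
    of 180 earned with probability at least one half is a mean drop of 90. *)
Lemma rate_start (q : R) : q <= 2^-1 -> t ^+ 180 + (1 - t ^+ 180) * q <= t ^+ 60.
Proof.
have := expr60_ge; have := expr180_le.
have : t ^+ 180 <= 1 by rewrite exprn_ile1 // ?ltW // near1_gt0.
move: t_lt1; set x := t ^+ 180; set y := t ^+ 60 => ?????.
by nra.
Qed.

(** Case of two: the mean drop is [f (60 + 29 (w - 1)) = 58 + 4 / (w + 1)]; something is forced with
    probability at least 4/7, so the bonus adds [20 / 7 > 2]. *)
Lemma rate_two (w f : R) : 2 <= w -> f * (w + 1) = 2 ->
  t ^+ 5 * (1 + f * ((1 - t ^+ 60) + (w - 1) * (1 - t ^+ 29)))^-1
    + (1 - t ^+ 5) * (1 + f * w)^-1 <= t ^+ 60.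
Proof.
move=> w2 fw; have f0 : 0 < f by nra.
have s0 : 0 < 1 - t by move: t_lt1; lra.
have s1 : 1 - t <= 1 / 1000 * (1 / 1000) by move: t_near1; lra.
have fwE : f * w = 2 - f by lra.
have fw43 : 4 / 3 <= f * w by nra.
set Y := f * _.
have YE : 2898 / 50 * (1 - t) <= Y.
  have := expr60_le; have := expr29_le; rewrite /Y.
  set x := t ^+ 60; set y := t ^+ 29; set s := 1 - t => hy hx.
  have h1 : 599 / 10 * s + (w - 1) * (2899 / 100 * s) <= (1 - x) + (w - 1) * (1 - y) by nra.
  apply: le_trans (ler_wpM2l (ltW f0) h1).
  rewrite [leRHS](_ : _ = (599 / 10 * f + (f * w - f) * (2899 / 100)) * s); last by field.
  by rewrite fwE ler_wpM2r //; [apply: ltW | lra].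
have Z : (1 + f * w)^-1 <= 3 / 7.
  by rewrite -[leRHS]invrK lef_pV2 ?posrE; lra.
have q : (1 + Y)^-1 <= 1 - 579 / 10 * (1 - t).
  have Y0 : 0 < 1 + Y by nra.
  by rewrite -[leLHS]mul1r ler_pdivrMr //; nra.
have := expr60_ge; have := expr5_le.
have : 0 <= t ^+ 5 by rewrite exprn_ge0 // ltW // near1_gt0.
move: Z q s0 s1; set x := t ^+ 5; set y := t ^+ 60; set s := 1 - t.
set z := (1 + Y)^-1; set z' := (1 + f * w)^-1 => Z q s0 s1 x0 x1 y1.
have h1 : x * z <= x * (1 - 579 / 10 * s) by apply: ler_wpM2l.
have h2 : (1 - x) * z' <= (1 - x) * (3 / 7) by apply: ler_wpM2l => //; nra.
by nra.
Qed.

(** Case of three or more: [f >= 3 / (w + 2)], so the mean drop is at least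
    [3 (31 + 29 w) / (w + 2)], which increases with [w] from 66.75 at [w = 2]. *)
Lemma rate_many (b w f : R) : 3 <= b -> 2 <= w -> f * (b + w - 1) = b ->
  (1 + f * ((1 - t ^+ 60) + (w - 1) * (1 - t ^+ 29)))^-1 <= t ^+ 60.
Proof.
move=> b3 w2 fE; have f3 : 3 <= f * (w + 2) by nra.
have f0 : 0 < f by nra.
have s0 : 0 < 1 - t by move: t_lt1; lra.
have s1 : 1 - t <= 1 / 1000 * (1 / 1000) by move: t_near1; lra.
set Y := f * _.
have YE : 65 * (1 - t) <= Y.
  have := expr60_le; have := expr29_le; rewrite /Y.
  set x := t ^+ 60; set y := t ^+ 29; set s := 1 - t => hy hx.
  have h1 : 599 / 10 * s + (w - 1) * (2899 / 100 * s) <= (1 - x) + (w - 1) * (1 - y) by nra.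
  apply: le_trans (ler_wpM2l (ltW f0) h1).
  have h2 : 65 / 3 * (w + 2) <= 599 / 10 + (w - 1) * (2899 / 100) by nra.
  have h3 : f * (65 / 3 * (w + 2)) <= f * (599 / 10 + (w - 1) * (2899 / 100)).
    by apply: ler_wpM2l => //; lra.
  rewrite [leRHS](_ : _ = f * (599 / 10 + (w - 1) * (2899 / 100)) * s); last by field.
  rewrite ler_wpM2r ?(ltW s0) //; apply: le_trans h3; rewrite mulrCA.
  by set fw2 := f * _ in f3 *; lra.
apply: le_trans expr60_ge; rewrite -[leLHS]mul1r ler_pdivrMr; nra.
Qed.

End Rates.

(** * Mean contraction of the potential *)

Section Contraction.

Variables (R : realType) (T : finType) (e : rel T).
Hypotheses (e_sym : symmetric e) (e_irr : irreflexive e).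
Variable t : R.
Hypotheses (t_lt1 : t < 1) (t_near1 : 1 - t <= 1 / 1000 * (1 / 1000)).

Let t_gt0 : 0 < t := near1_gt0 t_near1.

(** Take the vertex before the first white one. Unless it is [r], its predecessor on the path is a
    second blue closed neighbor. *)
Lemma frontier (r : T) (p : seq T) (B : {set T}) :
  path e r p -> r \in B -> last r p \notin B ->
  exists u y, [/\ u \in r :: p, y \in r :: p, u \in B, y \in neighbors e u :\: B
    & u != r -> (2 <= #|closed_neighbors e u :&: B|)%N].
Proof.
suff H x : path e x p -> x \in B -> last x p \notin B ->
    (x != r -> (2 <= #|closed_neighbors e x :&: B|)%N) ->
    exists u y, [/\ u \in x :: p, y \in x :: p, u \in B, y \in neighbors e u :\: B
      & u != r -> (2 <= #|closed_neighbors e u :&: B|)%N].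
  by move=> pP rB pB; apply: H; rewrite ?eqxx.
elim: p x => [|z p IH] x /=; first by move=> _ ->.
case/andP=> xz pP xB pB x2; case: (boolP (z \in B)) => [zB|zB]; last first.
  by exists x, z; split; rewrite ?mem_head // !inE ?eqxx ?orbT // zB.
have [//|u [y [up yp uB yW u2]]] := IH z pP zB pB.
  move=> _; rewrite (cardsD1 z) (cardsD1 x) !inE eqxx zB xB e_sym xz orbT.
  by case: eqP xz => [->|_]; rewrite ?e_irr.
by exists u, y; split=> //; rewrite inE ?up ?yp orbT.
Qed.

Definition potential (P : {set T}) (r v : T) (B : {set T}) : R :=
  if v \in B then 0 else t ^- cost e P r B.

Lemma potential_ge0 P r v B : 0 <= potential P r v B.
Proof. by rewrite /potential; case: ifP => // _; rewrite invr_ge0 exprn_ge0 // ltW. Qed.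

Lemma expVr_le (m B C : nat) : (C + m <= B)%N -> t ^- C <= t ^- B * t ^+ m.
Proof.
move=> CB; rewrite mulrC ler_pdivlMr ?exprn_gt0 // mulrC ler_pdivrMr ?exprn_gt0 //.
by rewrite -exprD ler_wiXn2l ?ltW // addnC.
Qed.

(** Only [y] is known to lie in [P]; any other forced vertex is credited with 29. *)
Definition gain (y z : T) : R := if z == y then t ^+ 60 else t ^+ 29.

Lemma prod_gain (F : {set T}) y :
  \prod_(z in F) gain y z = t ^+ (31 * (y \in F) + 29 * #|F|).
Proof.
rewrite (eq_bigr (fun z => t ^+ (31 * (z == y) + 29)%N)); last first.
  by move=> z _; rewrite /gain; case: eqP.
rewrite -expr_sum big_split /= sum_nat_const -big_distrr /=; congr (t ^+ (31 * _ + _)%N).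
  case yF: (y \in F); last first.
    by rewrite big1 // => z zF; case: eqP => // zy; rewrite -zy zF in yF.
  by rewrite (bigD1 y) //= eqxx big1 ?addn0 // => z /andP[_ /negbTE ->].
by rewrite mulnC.
Qed.

Lemma gain_bounds y z : 0 <= gain y z <= 1.
Proof.
by rewrite /gain; case: ifP => _; rewrite exprn_ge0 ?exprn_ile1 // ltW.
Qed.

Lemma expect_potential (P : {set T}) (r : T) (p : seq T) (B : {set T}) :
  path e r p -> P = [set x in r :: p] -> r \in B ->
  expect e B (potential P r (last r p)) <= t ^+ 60 * potential P r (last r p) B.
Proof.
move=> pP PE rB; rewrite expectE.
have [vB|vB] := boolP (last r p \in B).
  rewrite [potential _ _ _ B]/potential vB mulr0 big1 // => A _.
  by rewrite /potential inE vB mulr0.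
have [u [y [up yp uB yW u2]]] := frontier pP rB vB.
have uP : u \in P by rewrite PE finset.in_set.
have yP : y \in P by rewrite PE finset.in_set.
set W := neighbors e u :\: B in yW; set f := force_prob R e B u.
set b := #|closed_neighbors e u :&: B|; set w := #|W|.
have bw : (b + w = (deg e u).+1)%N by apply: closed_neighbors_split.
have b1 : (1 <= b)%N by apply/card_gt0P; exists u; rewrite !inE eqxx.
have w1 : (1 <= w)%N by apply/card_gt0P; exists y.
have d0 : (0 < (deg e u)%:R :> R) by rewrite ltr0n -ltnS -bw (leq_add b1 w1).
have fE : f * (b%:R + w%:R - 1) = b%:R.
  by rewrite -natrD bw -natr1 addrK /f /force_prob -/b divfK // gt_eqF.
have /andP[f0 f1] : 0 <= f <= 1.
  by apply: force_prob_bounds => //; apply/finset.set0Pn; exists y.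
(* Only forcings by [u] are credited; other successes cannot raise the cost. *)
pose F (A : {set T * T}) := [set z | (u, z) \in A].
have sumE (g : T -> R) : \sum_(A : {set T * T} | A \subset attempts e B)
    success_prob R e B A * \prod_(z in F A) g z
    = \prod_(z in W) (1 - f * (1 - g z)).
  rewrite -sum_success_from //; apply: eq_bigr => A _; congr (_ * _).
  by apply: eq_bigl => z; rewrite inE.
have sum_le (g : T -> R) : (forall z, 0 <= g z <= 1) ->
    \sum_(A : {set T * T} | A \subset attempts e B)
    success_prob R e B A * \prod_(z in F A) g z
    <= (1 + f * \sum_(z in W) (1 - g z))^-1.
  move=> g01; rewrite sumE mulr_sumr; apply: prod_1subr_le => z _.
  have /andP[g0 g1] := g01 z.
  by apply/andP; split; [rewrite mulr_ge0 | apply: mulr_ile1];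
    rewrite ?subr_ge0 // gerBl.
have gain_le := sum_le _ (gain_bounds y).
have sum_gain : \sum_(z in W) (1 - gain y z)
    = (1 - t ^+ 60) + (w%:R - 1) * (1 - t ^+ 29).
  rewrite (bigD1 y) //= /gain eqxx; congr (_ + _).
  rewrite (eq_bigr (fun=> 1 - t ^+ 29)); last by move=> z /andP[_ /negbTE ->].
  rewrite sumr_const -[_ *+ _]mulr_natl; congr (_ * _).
  rewrite (_ : #|_| = #|W :\ y|); last first.
    by apply: eq_card => z; rewrite finset.in_setD1 andbC.
  by rewrite /w (cardsD1 y W) yW natrD addrAC subrr add0r.
rewrite sum_gain in gain_le.
pose bonus (A : {set T * T}) := ((0 < #|F A|) * (5 * (big_deg e u && (b == 2))
                                 + 180 * ((u == r) && (b <= 1))))%N.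
have step (A : {set T * T}) : A \subset attempts e B ->
    potential P r (last r p) (B :|: [set p.2 | p in A])
    <= potential P r (last r p) B * (\prod_(z in F A) gain y z * t ^+ bonus A).
  move=> AB; rewrite [potential _ _ _ B]/potential (negbTE vB).
  apply: (@le_trans _ _ (t ^- cost e P r (B :|: [set p.2 | p in A]))).
    rewrite /potential; case: ifP => // _.
    by rewrite invr_ge0 exprn_ge0 // ltW.
  rewrite prod_gain -exprD; apply: expVr_le; rewrite addnA.
  apply: cost_decr => //; first exact: finset.subsetUl.
    apply/fintype.subsetP => z; rewrite !inE => zA; apply/orP; right.
    by apply/imsetP; exists (u, z).
  apply/fintype.subsetP => z; rewrite inE => /(fintype.subsetP AB).
  by rewrite !inE /= => /and3P[_ -> ->].
suff main : \sum_(A : {set T * T} | A \subset attempts e B)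
    success_prob R e B A * (\prod_(z in F A) gain y z * t ^+ bonus A) <= t ^+ 60.
  apply: (@le_trans _ _ (\sum_(A : {set T * T} | A \subset attempts e B)
      success_prob R e B A * (\prod_(z in F A) gain y z * t ^+ bonus A)
      * potential P r (last r p) B)).
    apply: ler_sum => A AB; rewrite -mulrA ler_wpM2l ?success_prob_ge0 //.
    by rewrite mulrC step.
  by rewrite -mulr_suml ler_wpM2r ?potential_ge0.
have t1 m : 0 <= t ^+ m <= 1 by rewrite exprn_ge0 ?exprn_ile1 // ltW.
have prod01 (A : {set T * T}) : 0 <= \prod_(z in F A) gain y z <= 1.
  by rewrite prod_gain t1.
(* As [0 ^+ 0 = 1], this product indicates that [u] forces nothing, so [sum_le] also bounds the
   probability of that event. *)
have prod0 (A : {set T * T}) : \prod_(z in F A) 0 = (#|F A| == 0)%:R :> R.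
  rewrite prodr_const; case: #|F A| => [|m]; first by rewrite expr0.
  by rewrite exprS mul0r.
have sum0 : \sum_(A : {set T * T} | A \subset attempts e B)
    success_prob R e B A * \prod_(z in F A) 0 <= (1 + f * w%:R)^-1.
  apply: le_trans (sum_le (fun=> 0) _) _; first by move=> z; rewrite lexx ler01.
  by rewrite subr0 sumr_const.
have sum1 : \sum_(A : {set T * T} | A \subset attempts e B)
    success_prob R e B A <= 1.
  apply: (@le_trans _ _ ((1 + f * \sum_(z in W) (1 - 1))^-1)).
    apply: le_trans (sum_le (fun=> 1) _); last by move=> z; rewrite ler01 lexx.
    by apply: ler_sum => A _; rewrite big1_eq mulr1.
  by rewrite subrr big1_eq mulr0 addr0 invr1.
(* Interpolation: [X] treats the bonus as always earned, and [Y] corrects for the event that nothing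
   is forced. *)
have mix (c : R) (H X Y : {set T * T} -> R) (x y' : R) : 0 <= c <= 1 ->
    (forall A : {set T * T}, A \subset attempts e B -> H A <= c * X A + (1 - c) * Y A) ->
    \sum_(A : {set T * T} | A \subset attempts e B) success_prob R e B A * X A <= x ->
    \sum_(A : {set T * T} | A \subset attempts e B) success_prob R e B A * Y A <= y' ->
    \sum_(A : {set T * T} | A \subset attempts e B) success_prob R e B A * H A
      <= c * x + (1 - c) * y'.
  move=> /andP[c0 c1] HXY Xx Yy.
  apply: le_trans (lerD (ler_wpM2l c0 Xx) (ler_wpM2l _ Yy)); last by rewrite subr_ge0.
  rewrite !mulr_sumr -big_split /=; apply: ler_sum => A AB.
  by rewrite mulrCA (mulrCA (1 - c)) -mulrDr ler_wpM2l ?success_prob_ge0 ?HXY.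
have [w_le1|w_gt1] := leqP w 1.
  have wE : w = 1%N by apply/eqP; rewrite eqn_leq w_le1.
  (* A single white neighbor is forced surely. The product is computed exactly, since
     [prod_1subr_le] would only give [1 / (2 - t ^+ 60)], which exceeds [t ^+ 60]. *)
  have f_1 : f = 1.
    have b0 : b%:R != 0 :> R by rewrite pnatr_eq0 -lt0n.
    by apply: (mulIf b0); rewrite mul1r -[RHS]fE wE addrK.
  apply: (@le_trans _ _ (\prod_(z in W) (1 - f * (1 - gain y z)))).
    rewrite -sumE; apply: ler_sum => A _; rewrite ler_wpM2l ?success_prob_ge0 //.
    by case/andP: (prod01 A) => p0 _; case/andP: (t1 (bonus A)) => _ ?; rewrite ler_piMr.
  have /cards1P[z WE] : #|W| == 1%N by rewrite -/w wE.
  have zy : z = y by apply/esym/finset.set1P; rewrite -WE.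
  by rewrite WE big_set1 zy f_1 /gain eqxx mul1r opprB addrC subrK.
have w2 : 2 <= w%:R :> R by rewrite ler_nat.
have [b_le1|b_gt1] := leqP b 1.
  have bE : b = 1%N by apply/eqP; rewrite eqn_leq b_le1.
  have ur : u = r by apply/eqP/negPn/negP => /u2; rewrite -/b bE.
  have fw : f * w%:R = 1 by move: fE; rewrite bE addrAC subrr add0r.
  apply: le_trans (rate_start t_lt1 t_near1 (lexx 2^-1)).
  apply: le_trans (mix (t ^+ 180) _ (fun=> 1) (fun A => \prod_(z in F A) 0)
    1 2^-1 (t1 180%N) _ _ _) _; last by rewrite mulr1.
  - move=> A _; rewrite prod0 /bonus bE ur eqxx andbF muln0 add0n muln1.
    have /andP[p0 p1] := prod01 A; have /andP[] := t1 180%N.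
    case: #|F A| => [|m]; rewrite ?mul0n ?mul1n; move: (t ^+ 180) => q q0 q1.
      by rewrite expr0 !mulr1 addrC subrK.
    by rewrite mulr1 mulr0 addr0 ler_piMl.
  - by under eq_bigr do rewrite mulr1.
  - by apply: le_trans sum0 _; rewrite fw.
have [b_le2|b_gt2] := leqP b 2.
  have bE : b = 2%N by apply/eqP; rewrite eqn_leq b_le2.
  (* Two blue closed neighbors and at least two white ones give [deg e u >= 3], so [u] still holds
     its bonus. *)
  have ub : big_deg e u by rewrite /big_deg -ltnS -bw bE.
  apply: le_trans (rate_two t_lt1 t_near1 w2 _); last first.
    by move: fE; rewrite bE => <-; congr (f * _); lra.
  apply: (mix _ _ (fun A => \prod_(z in F A) gain y z) (fun A => \prod_(z in F A) 0)) => //.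
  move=> A _; rewrite prod0 /bonus bE ub /= andbF muln0 addn0 muln1.
  have /andP[p0 p1] := prod01 A; have /andP[] := t1 5%N.
  case: #|F A| => [|m]; rewrite ?mul0n ?mul1n; move: (t ^+ 5) => q q0 q1.
    by rewrite expr0 !mulr1; nra.
  by rewrite mulr0 addr0 mulrC.
apply: le_trans (rate_many t_lt1 t_near1 _ w2 fE); last by rewrite ler_nat.
apply: le_trans gain_le; apply: ler_sum => A _; rewrite ler_wpM2l ?success_prob_ge0 //.
by case/andP: (prod01 A) => p0 _; case/andP: (t1 (bonus A)) => _ ?; rewrite ler_piMr.
Qed.

End Contraction.

(** * Propagation time *)

Section PropagationTime.

Variables (R : realType) (T : finType) (e : rel T).
Hypothesis e_irr : irreflexive e.

Implicit Types (B C : {set T}) (k : nat).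

(* [tail k B] is the probability that the propagation time from [B] exceeds [k]. *)
Fixpoint tail k B : R :=
  if B == [set: T] then 0
  else if k is k'.+1 then expect e B (tail k') else 1.

Lemma tail_setT k : tail k [set: T] = 0.
Proof. by case: k => [|k] /=; rewrite eqxx. Qed.

Lemma expect_le B (phi psi : {set T} -> R) : (forall C, phi C <= psi C) ->
  expect e B phi <= expect e B psi.
Proof. by move=> le; apply: ler_sum => C _; rewrite ler_wpM2l ?step_prob_ge0. Qed.

Lemma tail_bounds k B : 0 <= tail k B <= 1.
Proof.
elim: k B => [|k IH] B /=; case: ifP => _; rewrite ?lexx ?ler01 //.
apply/andP; split.
  by apply: sumr_ge0 => C _; rewrite mulr_ge0 ?step_prob_ge0 //; case/andP: (IH C).
apply: le_trans (expect_le (psi := fun=> 1) _ _) _.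
  by move=> C; case/andP: (IH C).
by rewrite /expect; under eq_bigr do rewrite mulr1; rewrite sum_step_prob.
Qed.

Lemma pt_prob_ge0 B k : 0 <= pt_prob R e B k.
Proof.
by apply: sumr_ge0 => b _; apply: prodr_ge0 => i _; apply: step_prob_ge0.
Qed.

Lemma pt_prob0 B : pt_prob R e B 0 = (B == [set: T])%:R.
Proof.
rewrite /pt_prob; case: eqP => [->|BT]; last first.
  rewrite big1 // => b /and3P[/eqP b0 /eqP b1 _]; case: BT.
  by rewrite -b0 -b1; congr (b _); apply: val_inj.
rewrite (big_pred1 [ffun=> [set: T]]) /trajectory_prob ?big_ord0 // => b.
apply/and3P/eqP => [[/eqP b0 _ _]|->].
  by apply/ffunP => i; rewrite ffunE -b0 (ord1 i).
by rewrite !ffunE; split=> //; apply/forallP => -[].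
Qed.

Definition cons_traj k B (b : {ffun 'I_k.+1 -> {set T}}) : {ffun 'I_k.+2 -> {set T}} :=
  [ffun i => if unlift ord0 i is Some j then b j else B].

Lemma cons_traj0 k B (b : {ffun 'I_k.+1 -> {set T}}) : cons_traj B b ord0 = B.
Proof. by rewrite ffunE unlift_none. Qed.

Lemma cons_traj_lift k B (b : {ffun 'I_k.+1 -> {set T}}) i :
  cons_traj B b (lift ord0 i) = b i.
Proof. by rewrite ffunE liftK. Qed.

(** First-step analysis: as [B] is not everything, prepending it to a trajectory preserves the
    stopping condition. *)
Lemma pt_probS B k : B != [set: T] ->
  pt_prob R e B k.+1 = expect e B (fun C => pt_prob R e C k).
Proof.
move=> BT; rewrite /expect /pt_prob.
rewrite (reindex_onto (@cons_traj k B)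
  (fun b => [ffun i => b (lift ord0 i)])) /=; last first.
  move=> b /and3P[/eqP b0 _ _]; apply/ffunP => i; rewrite ffunE.
  by case: unliftP => [j ->|->]; rewrite ?ffunE.
under [RHS]eq_bigr do rewrite mulr_sumr.
rewrite (partition_big (fun b : {ffun 'I_k.+1 -> {set T}} => b ord0) xpredT) //=.
have lift_max : ord_max = lift ord0 ord_max :> 'I_k.+2 by apply: val_inj.
have widen0 : widen_ord (leqnSn k.+1) ord0 = ord0 by apply: val_inj.
have widenS (i : 'I_k) : widen_ord (leqnSn k.+1) (lift ord0 i)
    = lift ord0 (widen_ord (leqnSn k) i) by apply: val_inj.
apply: eq_bigr => C _; apply: eq_big => b; last first.
  move=> /andP[_ /eqP bC]; rewrite /trajectory_prob big_ord_recl widen0 cons_traj0.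
  rewrite cons_traj_lift bC; congr (_ * _); apply: eq_bigr => i _.
  by rewrite widenS !cons_traj_lift.
rewrite cons_traj0 eqxx lift_max cons_traj_lift /=.
have -> : ([ffun i => cons_traj B b (lift ord0 i)] == b) = true.
  by apply/eqP/ffunP => i; rewrite ffunE cons_traj_lift.
rewrite andbT andbC; congr (_ && (_ && _)).
apply/forallP/forallP => [bT i|bT i].
  by have := bT (lift ord0 i); rewrite widenS cons_traj_lift.
case: (unliftP ord0 i) => [j ->|->]; first by rewrite widenS cons_traj_lift.
by rewrite widen0 cons_traj0.
Qed.

Lemma pt_prob_setT k : pt_prob R e [set: T] k.+1 = 0.
Proof.
rewrite /pt_prob big1 // => b /and3P[/eqP b0 _ /forallP/(_ ord0)].
by rewrite (_ : widen_ord _ _ = ord0) ?b0 ?eqxx //; apply: val_inj.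
Qed.

Lemma sum_pt_prob B k : \sum_(j < k.+1) pt_prob R e B j = 1 - tail k B.
Proof.
elim: k B => [|k IH] B.
  by rewrite big_ord_recl big_ord0 addr0 pt_prob0 /=; case: eqP; rewrite ?subr0 ?subrr.
rewrite big_ord_recl pt_prob0 /=; have [->|BT] := eqVneq B [set: T].
  by rewrite big1 ?addr0 ?subr0 // => i _; rewrite pt_prob_setT.
under eq_bigr do rewrite pt_probS //.
rewrite add0r exchange_big /= -(sum_step_prob R e B) -sumrB.
by apply: eq_bigr => C _; rewrite -mulr_sumr IH mulrBr mulr1.
Qed.

Lemma pt_prob_tail B k : pt_prob R e B k.+1 = tail k B - tail k.+1 B.
Proof.
have := sum_pt_prob B k.+1; rewrite big_ord_recr.
by move: (tail k.+1 B) => u /=; rewrite sum_pt_prob; lra.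
Qed.

(** Summation by parts: the finite form of the identity between a mean and the sum of its tails. *)
Lemma sum_mul_pt_prob B N :
  \sum_(k < N.+1) k%:R * pt_prob R e B k + N%:R * tail N B = \sum_(k < N) tail k B.
Proof.
elim: N => [|N IH]; first by rewrite big_ord_recr !big_ord0 /= !mul0r !addr0.
rewrite big_ord_recr [RHS]big_ord_recr [in RHS]/= -IH pt_prob_tail -natr1.
by move: (tail N.+1 B) => u /=; ring.
Qed.

Lemma sum_tail_le B (t c : R) m N : 0 < t < 1 -> 0 <= c ->
  (forall j, tail (m + j) B <= c * t ^+ j) ->
  \sum_(k < N) tail k B <= m%:R + c / (1 - t).
Proof.
move=> /andP[t0 t1] c0 tB.
have u0 k : 0 <= tail k B by case/andP: (tail_bounds k B).
apply: (@le_trans _ _ (\sum_(k < m + N) tail k B)).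
  by rewrite addnC big_split_ord /= lerDl sumr_ge0.
rewrite big_split_ord /= lerD //.
  rewrite -[X in X%:R](card_ord m) -sumr_const; apply: ler_sum => k _.
  by case/andP: (tail_bounds k B).
apply: le_trans (ler_wpM2l c0 (geometric_sum_le t0 t1 N)).
by rewrite mulr_sumr; apply: ler_sum => k _; apply: tB.
Qed.

Local Open Scope ereal_scope.

Lemma expected_pt_le B (t c : R) m : (0 < t < 1)%R -> (0 <= c)%R ->
  (forall j, (tail (m + j) B <= c * t ^+ j)%R) ->
  expected_pt R e B <= (m%:R + c / (1 - t))%:E.
Proof.
move=> t01 c0 tB; have /andP[t0 t1] := t01.
have tail0 : ((fun k => tail k B) @ \oo --> (0 : R)%R)%classic.
  rewrite -(cvg_shiftn m).
  apply: (@squeeze_cvgr _ _ _ _ (cst 0%R) (geometric c t)).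
  - apply: nearW => j /=; rewrite addnC tB andbT.
    by case/andP: (tail_bounds (m + j) B).
  - exact: cvg_cst.
  - by apply: cvg_geometric; rewrite ger0_norm // ltW.
(* Vanishing tails make the propagation time almost surely finite, so the infinite term becomes
   [+oo * 0 = 0]. *)
have infty0 : pt_infty_prob R e B = 0.
  rewrite /pt_infty_prob (_ : \sum_(0 <= k <oo) _ = 1) ?subee //.
  apply: cvg_lim => //; rewrite -cvg_shiftS.
  rewrite (_ : (fun _ => _) = (fun k => (1 - tail k B)%:E)); last first.
    by apply/funext => k; rewrite sumEFin big_mkord sum_pt_prob.
  apply: cvg_EFin; first exact: nearW.
  have := cvgB (cvg_cst (1 : R)%R) tail0; rewrite subr0; exact.
rewrite /expected_pt infty0 mule0 adde0.
apply: lime_le.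
  by apply: is_cvg_nneseries => k _ _; rewrite lee_fin mulr_ge0 // pt_prob_ge0.
apply: nearW => -[|N].
  by rewrite big_geq // lee_fin addr_ge0 // divr_ge0 ?subr_ge0 // ltW.
rewrite sumEFin big_mkord lee_fin.
apply: le_trans (sum_tail_le N t01 c0 tB); rewrite -sum_mul_pt_prob lerDl.
by rewrite mulr_ge0 //; case/andP: (tail_bounds N B).
Qed.

End PropagationTime.

(** * The bound on the expected propagation time *)

Section Bound.

Variables (R : realType) (T : finType) (e : rel T).
Hypotheses (e_sym : symmetric e) (e_irr : irreflexive e).
Variable t : R.
Hypotheses (t_lt1 : t < 1) (t_near1 : 1 - t <= 1 / 1000 * (1 / 1000)).

(** Union bound: a white [v] has potential at least 1, so the sum dominates the indicator that the
    process is unfinished, and each step contracts every summand because [r] stays blue. *)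
Lemma tail_le_potential (r : T) (p : T -> seq T) :
  (forall v, path e r (p v) /\ last r (p v) = v) ->
  forall k (B : {set T}), r \in B ->
  tail R e k B
    <= t ^+ (60 * k) * \sum_v potential e t [set x in r :: p v] r v B.
Proof.
move=> pP; have t0 := near1_gt0 t_near1.
have pot_ge0 k (B : {set T}) :
    0 <= t ^+ k * \sum_v potential e t [set x in r :: p v] r v B.
  rewrite mulr_ge0 ?exprn_ge0 ?(ltW t0) // sumr_ge0 // => v _.
  exact: potential_ge0.
elim=> [|k IH] B rB; have [->|BT] := eqVneq B [set: T];
  rewrite ?tail_setT // /= (negbTE BT).
  have /fintype.subsetPn[v _ vB] : ~~ ([set: T] \subset B) by rewrite finset.subTset.
  rewrite muln0 expr0 mul1r (bigD1 v) //= /potential (negbTE vB).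
  rewrite -[leLHS]addr0 lerD //; last first.
    by apply: sumr_ge0 => w _; apply: potential_ge0.
  by rewrite invf_ge1 ?exprn_gt0 // exprn_ile1 // ltW.
apply: (@le_trans _ _ (expect e B (fun C =>
    t ^+ (60 * k) * \sum_v potential e t [set x in r :: p v] r v C))).
  rewrite !expectE; apply: ler_sum => A _; rewrite ler_wpM2l ?success_prob_ge0 //.
  by apply: IH; rewrite inE rB.
rewrite mulnS addnC exprD -mulrA.
have -> : expect e B (fun C =>
    t ^+ (60 * k) * \sum_v potential e t [set x in r :: p v] r v C)
  = t ^+ (60 * k) * \sum_v expect e B (potential e t [set x in r :: p v] r v).
  rewrite /expect exchange_big mulr_sumr /=; apply: eq_bigr => C _.
  by rewrite mulrCA mulr_sumr.
rewrite ler_wpM2l ?exprn_ge0 ?(ltW t0) // mulr_sumr; apply: ler_sum => v _.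
have [pathv lastv] := pP v.
by have := expect_potential e_sym e_irr t_lt1 t_near1 pathv erefl rB; rewrite lastv.
Qed.

Lemma ept_le : (0 < #|T|)%N -> connected_graph e ->
  (ept R e <= ((uphalf #|T|)%:R + 3 / (1 - t) * t ^- 2175 / (1 - t))%:E)%E.
Proof.
move=> T0 e_conn; have t0 := near1_gt0 t_near1.
have [r [p pP sum_p]] := sum_initial_cost e_sym e_irr e_conn t0 t_lt1 T0.
apply: (@le_trans _ _ (expected_pt R e [set r])); first exact: bigmin_le_cond.
apply: (expected_pt_le e_irr (t := t)); first by rewrite t0.
  by rewrite !mulr_ge0 ?invr_ge0 ?subr_ge0 ?exprn_ge0 ?(ltW t0) ?(ltW t_lt1).
move=> j; apply: le_trans (tail_le_potential pP _ (finset.set11 r)) _.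
apply: (@le_trans _ _ (t ^+ (60 * (uphalf #|T| + j)) *
    (3 / (1 - t) * t ^- (30 * #|T| + 2175)))).
  rewrite ler_wpM2l ?exprn_ge0 ?(ltW t0) //; apply: le_trans sum_p.
  apply: ler_sum => v _; rewrite /potential; case: ifP => _.
    by rewrite invr_ge0 exprn_ge0 // ltW.
  rewrite lef_pV2 ?posrE ?exprn_gt0 // ler_wiXn2l ?(ltW t0) ?(ltW t_lt1) //.
  exact: cost_le_initial.
have c0 : 0 <= 3 / (1 - t) by rewrite mulr_ge0 ?invr_ge0 ?subr_ge0 // ltW.
move: (3 / (1 - t)) c0 => c c0; rewrite mulrCA -mulrA ler_wpM2l //.
rewrite ler_pdivrMr ?exprn_gt0 // -mulrA [leRHS]mulrC ler_pdivlMr ?exprn_gt0 //.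
(* [60 * uphalf n >= 30 * n] cancels the initial potential, and [60 * j >= j] leaves the decay. *)
rewrite -!exprD ler_wiXn2l ?(ltW t0) ?(ltW t_lt1) //.
by rewrite -(odd_double_half #|T|) uphalf_half; lia.
Qed.

End Bound.

Theorem theorem1p4 (R : realType) :
  exists K : R,
    forall (n : nat) (T : finType) (e : rel T),
      (1 <= n)%N -> #|T| = n -> simple_graph e -> connected_graph e ->
      (ept R e <= (n%:R / 2 + K)%:E)%E.
Proof.
pose t : R := 1 - 1 / 1000 * (1 / 1000).
have t_lt1 : t < 1 by rewrite /t; lra.
have t_near1 : 1 - t <= 1 / 1000 * (1 / 1000) by rewrite /t; lra.
(* The leading 1 absorbs the rounding of [n / 2] up to [uphalf n]. *)
exists (1 + 3 / (1 - t) * t ^- 2175 / (1 - t)) => n T e n1 Tn [e_sym e_irr] e_conn.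
apply: le_trans (ept_le e_sym e_irr t_lt1 t_near1 _ e_conn) _; first by rewrite Tn.
rewrite Tn lee_fin addrA lerD2r.
have : (uphalf n * 2)%:R <= (n + 1)%:R :> R.
  by rewrite ler_nat -[X in (_ <= X + 1)%N]odd_double_half uphalf_half; lia.
by rewrite natrM natrD; lra.
Qed.
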